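(* Let $\Lambda=\{0,1\}^{n(n-1)/2}$ and let $X=(X_{ij})_{1\le i<j\le n}$ be the edge indicators of an exponential random graph on $n$ vertices, i.e. $X$ is distributed on $\Lambda$ according to $$p_\beta(G)=\exp\left(\sum_{i=1}^k\beta_iT_i(G)-\psi(\beta)\right),$$ where $\beta=(\beta_1,\ldots,\beta_k)\in\mathbb{R}^k$, $T_1,\ldots,T_k$ are real functions on the space of graphs on $n$ vertices, and $\psi(\beta)$ is the normalizing constant. Suppose that $\beta$ is such that $X$ satisfies the Dobrushin condition, i.e. there is a Dobrushin interdependence matrix $A$ for $X$ with $\|A\|_1<1$ and $\|A\|_\infty<1$. Let $S$ be a fixed graph with $n_S$ vertices and $e_S$ edges, and let $N_S$ denote the number of copies of $S$ in the exponential random graph. Then for any $t\ge0$, $$\mathbb{P}(N_S-\mathbb{E}(N_S)\ge t)\le\exp\left(-\frac{(1-\|A\|_1)t^2}{2\binom{n-2}{n_S-2}e_S\cdot(\mathbb{E}(N_S)+t)}\right),$$ $$\mathbb{P}(N_S-\mathbb{E}(N_S)\le-t)\le\exp\left(-\frac{(1-\|A\|_1)t^2}{8\binom{n-2}{n_S-2}e_S\cdot\mathbb{E}(N_S)}\right).$$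
   Context: The number of copies of $S$ is the number of subsets of size $n_S$ of the set of $n$ vertices such that the corresponding (induced) subgraph contains $S$ as a subgraph. It is assumed that $e_S\ge1$ and $2\le n_S\le n$, so that the expressions are well defined. For a random vector $X=(X_e)_{e\in E}$ indexed by a finite set $E$ (here the set of pairs $i<j$), $X_{-e}$ is $X$ with coordinate $e$ dropped, and $\mu_e(\cdot|x_{-e})=\mathbb{P}(X_e\in\cdot\,|\,X_{-e}=x_{-e})$. A matrix $A=(a_{ef})_{e,f\in E}$ with non-negative entries and zeros on the diagonal is a Dobrushin interdependence matrix for $X$ if for every $e$ and every $x,y\in\Lambda$, $$d_{\mathrm{TV}}(\mu_e(\cdot|x_{-e}),\mu_e(\cdot|y_{-e}))\le\sum_{f\ne e}a_{ef}\mathbf{1}[x_f\ne y_f],$$ where $d_{\mathrm{TV}}(\nu_1,\nu_2)=\sup_B|\nu_1(B)-\nu_2(B)|$ is the total variation distance. $\|A\|_1=\max_f\sum_e|a_{ef}|$, $\|A\|_\infty=\max_e\sum_f|a_{ef}|$. *)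

(* Defs.v *)
From HB Require Import structures.
From mathcomp Require Import all_boot all_order all_algebra.
From mathcomp Require Import reals exp sequences.

Set Implicit Arguments.
Unset Strict Implicit.
Unset Printing Implicit Defensive.

Import Order.TTheory GRing.Theory Num.Theory.

Local Open Scope ring_scope.

(* Laws of random vectors X = (X_e)_(e : E) with finitely many values: such a
   law is given by its probability mass function on {ffun E -> T}. *)
Section RandomVector.
Variables (R : realType) (E T : finType).
Implicit Types (p : {ffun E -> T} -> R) (e f : E) (x y z : {ffun E -> T}).

Definition prob p (B : pred {ffun E -> T}) : R := \sum_(x | B x) p x.

Definition expect p (F : {ffun E -> T} -> R) : R := \sum_x F x * p x.

(* x_{-e} = y_{-e} *)
Definition eq_off e x y : bool := [forall f, (f != e) ==> (x f == y f)].

(* mu_e(B | x_{-e}), as an elementary conditional probability: it is only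
   meaningful when the conditioning event has positive probability (always the
   case for an exponential random graph). *)
Definition cond_law p e x (B : {set T}) : R :=
  prob p [pred z : {ffun E -> T} | (z e \in B) && eq_off e z x] / prob p [pred z : {ffun E -> T} | eq_off e z x].

(* T is finite, so that the supremum over measurable sets is a maximum over
   all subsets; the default value 0 is attained at B = set0. *)
Definition dTV (mu nu : {set T} -> R) : R :=
  \big[Num.max/0]_(B : {set T}) `|mu B - nu B|.

Definition dobrushin_matrix p (A : E -> E -> R) : Prop :=
  [/\ forall e f, 0 <= A e f,
      forall e, A e e = 0 &
      forall e x y, dTV (cond_law p e x) (cond_law p e y) <=
        \sum_(f | f != e) A e f * (x f != y f)%:R].

Definition norm1 (A : E -> E -> R) : R :=
  \big[Num.max/0]_f \sum_e `|A e f|.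

Definition norm_infty (A : E -> E -> R) : R :=
  \big[Num.max/0]_e \sum_f `|A e f|.

End RandomVector.

Definition vpair (n : nat) : finType :=
  {e : 'I_n * 'I_n | (nat_of_ord e.1 < nat_of_ord e.2)%N}.

(* Simple graphs on the vertex set 'I_n, encoded by their edge indicators. *)
Definition graph (n : nat) := {ffun vpair n -> bool}.

Definition adj (n : nat) (G : graph n) (u v : 'I_n) : bool :=
  [exists e : vpair n, G e && ((val e == (u, v)) || (val e == (v, u)))].

Definition num_edges (n : nat) (G : graph n) : nat := #|[set e | G e]|.

(* The subgraph of G induced by W contains (a copy of) S as a subgraph, not
   necessarily an induced one. *)
Definition contains_in (m n : nat) (S : graph m) (G : graph n)
    (W : {set 'I_n}) : bool :=
  [exists h : {ffun 'I_m -> 'I_n},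
    [&& injectiveb h, [forall u, h u \in W] &
        [forall u, forall v, adj S u v ==> adj G (h u) (h v)]]].

Definition num_copies (m n : nat) (S : graph m) (G : graph n) : nat :=
  #|[set W : {set 'I_n} | (#|W| == m) && contains_in S G W]|.

Section ExponentialRandomGraph.
Variables (R : realType) (n k : nat).
Variables (T : 'I_k -> graph n -> R) (beta : 'I_k -> R).

Definition ergm_psi : R :=
  ln (\sum_(G : graph n) expR (\sum_(i < k) beta i * T i G)).

Definition ergm (G : graph n) : R :=
  expR (\sum_(i < k) beta i * T i G - ergm_psi).

End ExponentialRandomGraph.

(* Main.v *)
Require Import Defs.
From HB Require Import structures.
From mathcomp Require Import boolp classical_sets functions.
From mathcomp Require Import all_boot all_order all_algebra.
From mathcomp Require Import reals topology normedtype sequences derive.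
From mathcomp Require Import realfun exp.
From mathcomp Require Import ring lra zify.

(* For functions [f], [w] of the random edge vector, the Glauber dynamics
   contracts the Lipschitz constant of [f] (for single-edge changes) by the
   factor 1 - (1 - ||A||_1) / #edges, while one step of it changes Cov(f, w) by
   a Dirichlet form. Summing over all steps gives
     Cov(f, w) <= Lip(f) / (1 - ||A||_1) *
                  sum_e E[|w(X) - w(X without e)|; X_e = 1].
   For f = N_S the Lipschitz constant is at most C(n-2, n_S-2), and
   sum_(e in X) (f(X) - f(X without e)) <= e_S f(X), because the destruction of
   a copy requires the deletion of one of the e_S edges of a fixed embedding.
   With w = exp(s f) the covariance is thus at most s C E[f exp(s f)], a
   differential inequality for the Laplace transform, and Herbst's argument
   concludes; the lower tail uses w = - exp(- s f). *)

Set Implicit Arguments.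
Unset Strict Implicit.
Unset Printing Implicit Defensive.

Import Order.TTheory GRing.Theory Num.Theory numFieldNormedType.Exports.

Local Open Scope ring_scope.

(** * Single-site updates, conditional laws and the Glauber dynamics *)

Definition upd (E : finType) (x : {ffun E -> bool}) (e : E) (b : bool) :
    {ffun E -> bool} := [ffun f => if f == e then b else x f].

Section Resampling.
Variables (R : realType) (E : finType).
Implicit Types (x y z : {ffun E -> bool}) (e f : E).
Implicit Types (h w : {ffun E -> bool} -> R).

Lemma upd_eq x e b : upd x e b e = b.
Proof. by rewrite ffunE eqxx. Qed.

Lemma upd_id x e : upd x e (x e) = x.
Proof. by apply/ffunP => f; rewrite ffunE; case: eqP => // ->. Qed.

Lemma upd_upd x e b c : upd (upd x e b) e c = upd x e c.
Proof. by apply/ffunP => f; rewrite !ffunE; case: eqP. Qed.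

Lemma updC x e f b c : e != f -> upd (upd x e b) f c = upd (upd x f c) e b.
Proof.
move=> ef; apply/ffunP => g; rewrite !ffunE.
by case: (eqVneq g f) => // ->; rewrite eq_sym (negbTE ef).
Qed.

Lemma eq_off_upd e z x : eq_off e z x = (z == upd x e (z e)).
Proof.
apply/forallP/eqP => [zx|zx f].
  apply/ffunP => f; rewrite ffunE; case: (eqVneq f e) => [-> //|fe].
  by have /implyP/(_ fe)/eqP := zx f.
by apply/implyP => fe; rewrite zx ffunE (negbTE fe).
Qed.

Lemma sum_upd (F : {ffun E -> bool} -> R) e :
  \sum_x F x = \sum_(x : {ffun E -> bool} | x e) (F x + F (upd x e false)).
Proof.
rewrite (bigID (fun x : {ffun E -> bool} => x e)) /= big_split /=; congr (_ + _).
rewrite (reindex_onto (fun x => upd x e false) (fun x => upd x e true)) /=.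
  apply: eq_bigl => x; rewrite upd_eq /= upd_upd.
  apply/eqP/idP => [<-|xe]; first by rewrite upd_eq.
  by rewrite -[in RHS](upd_id x e) xe.
by move=> x /negbTE xe; rewrite upd_upd -xe upd_id.
Qed.

Definition coord_lipschitz (B : R) h :=
  forall e x, `|h (upd x e true) - h (upd x e false)| <= B.

Lemma coord_lipschitz_upd B h x e b :
  coord_lipschitz B h -> `|h x - h (upd x e b)| <= B.
Proof.
move=> hB; have B0 : 0 <= B := le_trans (normr_ge0 _) (hB e x).
rewrite -{1}(upd_id x e); case: (x e); case: b; rewrite ?subrr ?normr0 //.
by rewrite distrC.
Qed.

Lemma coord_lipschitz_diam B h x y : 0 <= B -> coord_lipschitz B h ->
  `|h x - h y| <= #|E|%:R * B.
Proof.
move=> B0 hB.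
(* Induction on a bound for the Hamming distance of [x] and [y]; each step corrects one coordinate
   of [x]. *)
suff H k : forall x, (#|[set e | x e != y e]| <= k)%N -> `|h x - h y| <= k%:R * B.
  by apply: H; rewrite max_card.
elim: k => [|k IH] {}x.
  rewrite leqn0 cards_eq0 => /eqP xy.
  suff -> : x = y by rewrite subrr normr0 mul0r.
  apply/ffunP => e; apply/eqP; apply: contraFT (in_set0 e) => ne.
  by rewrite -xy inE.
move=> le; have [xy|[e exy]] := set_0Vmem [set e | x e != y e].
  apply: (@le_trans _ _ (k%:R * B)); last first.
    by rewrite ler_wpM2r // ler_nat.
  by apply: IH; rewrite xy cards0.
rewrite (cardsD1 e) exy add1n ltnS in le.
rewrite -nat1r mulrDl mul1r.
apply: le_trans (ler_distD (h (upd x e (y e))) _ _) _.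
apply: lerD; first exact: coord_lipschitz_upd.
apply: IH; apply: leq_trans le; apply: subset_leq_card.
apply/subsetP => f; rewrite !inE ffunE; case: (eqVneq f e) => [->|//].
by rewrite eqxx.
Qed.

Variable p : {ffun E -> bool} -> R.
Hypothesis p_gt0 : forall x, 0 < p x.

Definition prob_true e x : R :=
  p (upd x e true) / (p (upd x e true) + p (upd x e false)).

Lemma cond_law_true e x : cond_law p e x [set true] = prob_true e x.
Proof.
rewrite /cond_law /prob_true /prob; congr (_ / _).
  rewrite (big_pred1 (upd x e true)) // => z /=.
  rewrite inE eq_off_upd; apply/andP/eqP => [[/eqP ze /eqP zx]|->].
    by rewrite {1}zx ze.
  by rewrite upd_eq !eqxx.
rewrite (bigID (fun z : {ffun E -> bool} => z e)) /=; congr (_ + _).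
  rewrite (big_pred1 (upd x e true)) // => z /=.
  rewrite eq_off_upd; apply/andP/eqP => [[/eqP zx ze]|->].
    by rewrite {1}zx ze.
  by rewrite upd_eq !eqxx.
rewrite (big_pred1 (upd x e false)) // => z /=.
rewrite eq_off_upd; apply/andP/eqP => [[/eqP zx /negbTE ze]|->].
  by rewrite {1}zx ze.
by rewrite upd_eq !eqxx.
Qed.

Lemma prob_true_ge0 e x : 0 <= prob_true e x.
Proof. by rewrite /prob_true divr_ge0 // ltW // addr_gt0. Qed.

Lemma prob_true_le1 e x : prob_true e x <= 1.
Proof. by rewrite /prob_true ler_pdivrMr ?addr_gt0 // mul1r lerDl ltW. Qed.

Lemma prob_true_upd e x b : prob_true e (upd x e b) = prob_true e x.
Proof. by rewrite /prob_true !upd_upd. Qed.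

(** The event [[set true]] bounds the total variation distance from below, and the two
    configurations differ only at [f], so a single entry of [A] survives. *)
Lemma dobrushin_prob_true (A : E -> E -> R) e f x :
  dobrushin_matrix p A -> f != e ->
  `|prob_true e (upd x f true) - prob_true e (upd x f false)| <= A e f.
Proof.
case=> A0 _ hA fe; rewrite -!cond_law_true.
apply: le_trans (le_trans _ (hA e (upd x f true) (upd x f false))) _.
  by rewrite /dTV; apply: (le_bigmax _ (fun B : {set bool} =>
    `|cond_law p e (upd x f true) B - cond_law p e (upd x f false) B|)).
rewrite (bigD1 f) //= !upd_eq mulr1 big1 ?addr0 // => g /andP[_ gf].
by rewrite !ffunE (negbTE gf) eqxx mulr0.
Qed.

(** Conditional expectation of [h] given all coordinates other than [e]. *)
Definition resample e h x : R :=
  prob_true e x * h (upd x e true) + (1 - prob_true e x) * h (upd x e false).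

Lemma resample_upd e h x b : resample e h (upd x e b) = resample e h x.
Proof. by rewrite /resample prob_true_upd !upd_upd. Qed.

(* The right-hand side is the Dirichlet form of the resampling of [e], which is
   reversible for [p]. *)
Lemma resample_dirichlet e h w :
  \sum_x (h x - resample e h x) * w x * p x =
  \sum_(x : {ffun E -> bool} | x e) p x * (1 - prob_true e x) *
    ((h x - h (upd x e false)) * (w x - w (upd x e false))).
Proof.
rewrite (sum_upd _ e); apply: eq_bigr => x xe.
rewrite resample_upd /resample /prob_true.
have -> : upd x e true = x by rewrite -[RHS](upd_id x e) xe.
have := p_gt0 x; have := p_gt0 (upd x e false).
move: (p x) (p (upd x e false)) => a b b0 a0.
have ab : a + b != 0 by rewrite gt_eqF // addr_gt0.
by field.
Qed.

Lemma expect_resample e h : expect p (resample e h) = expect p h.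
Proof.
have := resample_dirichlet e h (fun=> 1).
rewrite [RHS]big1 => [|x _]; last by rewrite subrr !mulr0.
under eq_bigr do rewrite mulr1 mulrBl.
by rewrite sumrB => /eqP; rewrite subr_eq0 => /eqP.
Qed.

Definition glauber h x : R := (\sum_e resample e h x) / #|E|%:R.

Lemma resample_lipschitz (A : E -> E -> R) B h e f x :
  dobrushin_matrix p A -> 0 <= B -> coord_lipschitz B h ->
  `|resample e h (upd x f true) - resample e h (upd x f false)| <=
    (f != e)%:R * B + A e f * B.
Proof.
move=> hA B0 hB; have [-> |fe] := eqVneq f e.
  by rewrite !resample_upd subrr normr0 mul0r add0r mulr_ge0 //; case: hA.
rewrite mul1r /resample !(updC _ _ _ fe).
set q1 := prob_true e (upd x f true); set q0 := prob_true e _.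
set h11 := h _; set h01 := h _; set h10 := h _; set h00 := h _.
(* The first part compares [h] across [f] under one resampling probability; the second charges the
   change of that probability, at most [A e f], against the jump of [h] at [e]. *)
have -> : q1 * h11 + (1 - q1) * h01 - (q0 * h10 + (1 - q0) * h00) =
  (q1 * (h11 - h10) + (1 - q1) * (h01 - h00)) + (q1 - q0) * (h10 - h00) by ring.
apply: le_trans (ler_normD _ _) _; apply: lerD.
  apply: le_trans (ler_normD _ _) _; rewrite (normrM q1) (normrM (1 - q1)).
  have q1_ge0 : 0 <= q1 by exact: prob_true_ge0.
  have q1_le1 : q1 <= 1 by exact: prob_true_le1.
  rewrite (ger0_norm q1_ge0) (@ger0_norm _ (1 - q1)) ?subr_ge0 //.
  have -> : B = q1 * B + (1 - q1) * B by ring.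
  by apply: lerD; apply: ler_wpM2l; rewrite ?subr_ge0 //; apply: hB.
rewrite normrM ler_pM //; first exact: dobrushin_prob_true.
by rewrite /h10 /h00 -!(updC _ _ _ fe); apply: hB.
Qed.

(** For fixed [f], summing over the resampled site [e] yields a column sum of [A], hence [norm1];
    resampling [f] itself erases the discrepancy, which saves one [B]. *)
Lemma glauber_lipschitz (A : E -> E -> R) B h :
  dobrushin_matrix p A -> (0 < #|E|)%N -> 0 <= B -> coord_lipschitz B h ->
  coord_lipschitz ((1 - (1 - norm1 A) / #|E|%:R) * B) (glauber h).
Proof.
move=> hA E0 B0 hB f x; have N0 : 0 < #|E|%:R :> R by rewrite ltr0n.
rewrite /glauber -mulrBl -sumrB normrM (@ger0_norm _ #|E|%:R^-1); last first.
  by rewrite invr_ge0 ltW.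
rewrite ler_pdivrMr //; apply: le_trans (ler_norm_sum _ _ _) _.
apply: le_trans (ler_sum _ (fun e _ => resample_lipschitz e f x hA B0 hB)) _.
rewrite big_split /= -!mulr_suml.
have -> : \sum_e (f != e)%:R = #|E|%:R - 1 :> R.
  rewrite (bigD1 f) //= eqxx add0r (eq_bigr (fun=> 1)) => [|e ef]; last first.
    by rewrite eq_sym ef.
  by rewrite sumr_const (cardC1 f) -subn1 natrB.
have : \sum_e A e f <= norm1 A.
  apply: le_trans (le_bigmax _ (fun f => \sum_e `|A e f|) f).
  by apply: ler_sum => e _; apply: ler_norm.
move=> /(ler_wpM2r B0) le; apply: le_trans (lerD (lexx _) le) _.
rewrite le_eqVlt; apply/orP; left; apply/eqP.
have := N0; rewrite lt0r => /andP[N_neq0 _].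
by field.
Qed.
End Resampling.

(** * Covariance bounds by iterating the Glauber dynamics *)

Section Covariance.
Variables (R : realType) (E : finType).
Implicit Types (x y z : {ffun E -> bool}) (e f : E).
Implicit Types (h w : {ffun E -> bool} -> R).
Variable p : {ffun E -> bool} -> R.
Hypothesis p_gt0 : forall x, 0 < p x.

Definition covariance h w : R :=
  expect p (fun x => h x * w x) - expect p h * expect p w.

(** Only deletions of present edges are charged; this one-sided form is what self-bounding controls
    later. *)
Definition gradient_mass w : R :=
  \sum_e \sum_(x : {ffun E -> bool} | x e) p x * `|w x - w (upd x e false)|.

Lemma le_limit_geometric (a b d r : R) : 0 <= r < 1 ->
  (forall k, a <= b + r ^+ k * d) -> a <= b.
Proof.
move=> /andP[r0 r1] le; rewrite leNgt; apply/negP => ba.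
(* The case [k = 0] gives [a <= b + d], so [b < a] forces [d > 0]. *)
have d0 : 0 < d by move: (le 0%N); rewrite expr0; lra.
have : ((fun k => r ^+ k) @ \oo --> (0 : R))%classic.
  by apply: cvg_expr; rewrite ger0_norm.
move=> /cvgr0Pnorm_lt /(_ ((a - b) / d)) [|k _ /(_ k (leqnn k)) /=].
  by rewrite divr_gt0 // subr_gt0.
rewrite ger0_norm ?exprn_ge0 // ltr_pdivlMr // ltNge => /negP; apply.
by rewrite lerBlDl.
Qed.

Lemma expect_glauber h : (0 < #|E|)%N -> expect p (glauber p h) = expect p h.
Proof.
move=> E0; rewrite {1}/expect /glauber.
under eq_bigr do rewrite mulrAC mulr_suml.
rewrite -mulr_suml exchange_big /=.
under eq_bigr => e _ do rewrite -/(expect p (resample p e h)) expect_resample //.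
by rewrite sumr_const -[X in X / _]mulr_natr; apply: mulfK; rewrite pnatr_eq0 -lt0n.
Qed.

Lemma resample_increment_le B h w e : coord_lipschitz B h ->
  \sum_x (h x - resample p e h x) * w x * p x <=
  B * \sum_(x : {ffun E -> bool} | x e) p x * `|w x - w (upd x e false)|.
Proof.
move=> hB; rewrite resample_dirichlet // mulr_sumr; apply: ler_sum => x xe.
have q0 := prob_true_ge0 p_gt0 e x; have q1 := prob_true_le1 p_gt0 e x.
rewrite -mulrA [leRHS]mulrCA; apply: ler_wpM2l; first exact/ltW.
apply: le_trans (ler_norm _) _; rewrite !normrM mulrA.
apply: ler_wpM2r => //; rewrite -[leRHS]mul1r.
by apply: ler_pM => //; [rewrite ger0_norm; lra | exact: coord_lipschitz_upd].
Qed.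

(** Stationarity of [p] preserves the expectation of [h], so the products of expectations cancel and
    only averaged Dirichlet forms remain. *)
Lemma covariance_glauber B h w : (0 < #|E|)%N -> coord_lipschitz B h ->
  covariance h w <= covariance (glauber p h) w + B * gradient_mass w / #|E|%:R.
Proof.
move=> E0 hB; rewrite /covariance expect_glauber // addrAC lerD2r -lerBlDl.
rewrite ler_pdivlMr ?ltr0n //.
have -> : (expect p (fun x => h x * w x) -
    expect p (fun x => glauber p h x * w x)) * #|E|%:R =
    \sum_e \sum_x (h x - resample p e h x) * w x * p x.
  rewrite exchange_big /= /expect -sumrB mulr_suml; apply: eq_bigr => x _.
  rewrite -!mulr_suml sumrB sumr_const /glauber -mulr_natr.
  have N0 : #|E|%:R != 0 :> R by rewrite pnatr_eq0 -lt0n.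
  by field.
rewrite mulr_sumr; apply: ler_sum => e _; exact: resample_increment_le.
Qed.

Hypothesis p1 : \sum_x p x = 1.

(** Crude bound that starts the iteration; being linear in [B], it decays along with the Lipschitz
    constant. *)
Lemma covariance_diam B h w : 0 <= B -> coord_lipschitz B h ->
  covariance h w <= #|E|%:R * B * expect p (fun x => `|w x|).
Proof.
move=> B0 hB.
have -> : covariance h w = \sum_x (h x - expect p h) * w x * p x.
  rewrite /covariance {2}/expect /expect mulr_sumr -sumrB.
  by apply: eq_bigr => x _; ring.
rewrite /expect mulr_sumr; apply: ler_sum => x _.
rewrite mulrA; apply: ler_wpM2r; first exact/ltW.
apply: le_trans (ler_norm _) _; rewrite normrM; apply: ler_wpM2r => //.
have -> : h x - expect p h = \sum_y (h x - h y) * p y.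
  under eq_bigr do rewrite mulrBl.
  by rewrite sumrB -mulr_sumr p1 mulr1.
apply: le_trans (ler_norm_sum _ _ _) _.
rewrite -[leRHS]mulr1 -[X in _ <= _ * X]p1 mulr_sumr; apply: ler_sum => y _.
rewrite normrM (gtr0_norm (p_gt0 y)); apply: ler_wpM2r; first exact/ltW.
exact: coord_lipschitz_diam.
Qed.

(* Iterating the Glauber dynamics, which contracts Lipschitz constants by the
   factor [1 - (1 - norm1 A) / #|E|], down to equilibrium. *)
Lemma covariance_le (A : E -> E -> R) B h w :
  dobrushin_matrix p A -> norm1 A < 1 -> (0 < #|E|)%N -> 0 <= B ->
  coord_lipschitz B h -> covariance h w <= B / (1 - norm1 A) * gradient_mass w.
Proof.
move=> hA A1 E0 B0 hB; set r := 1 - (1 - norm1 A) / #|E|%:R.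
have N1 : 1 <= #|E|%:R :> R by rewrite ler1n.
have N0 : 0 < #|E|%:R :> R by rewrite ltr0n.
have A0 : 0 <= norm1 A by rewrite bigmax_ge_id.
have r0 : 0 <= r by rewrite subr_ge0 ler_pdivrMr // mul1r; lra.
have r1 : r < 1 by rewrite ltrBlDr ltrDl divr_gt0 // subr_gt0.
apply: (@le_limit_geometric _ _ (#|E|%:R * B * expect p (fun x => `|w x|)) r).
  by rewrite r0.
move=> k; elim: k B h B0 hB => [|k IH] B h B0 hB.
  rewrite expr0 mul1r; apply: le_trans (covariance_diam _ B0 hB) _.
  rewrite lerDr mulr_ge0 //; first by rewrite divr_ge0 // subr_ge0 ltW.
  by do 2!(apply: sumr_ge0 => ? _); rewrite mulr_ge0 // ltW.
apply: le_trans (covariance_glauber _ E0 hB) _.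
have hB' := glauber_lipschitz p_gt0 hA E0 B0 hB.
apply: le_trans (lerD (IH _ _ (mulr_ge0 r0 B0) hB') (lexx _)) _.
(* [B / (1 - norm1 A)] is a fixed point of multiplying by [r] and adding [B / #|E|]; the error term
   gains one factor [r]. *)
rewrite le_eqVlt; apply/orP; left; apply/eqP; rewrite exprSr /r.
have A1' : 1 - norm1 A != 0 by rewrite gt_eqF // subr_gt0.
have N0' : #|E|%:R != 0 :> R by rewrite gt_eqF.
by field; rewrite N0'.
Qed.
End Covariance.

(** * Herbst's argument and the Chernoff bound *)

Section Herbst.
Variables (R : realType) (I : finType).

Lemma is_derive_big_sum (F : I -> R -> R) (dF : I -> R) (a : R) :
  (forall i, is_derive a 1 (F i) (dF i)) ->
  is_derive a 1 (fun s => \sum_i F i s) (\sum_i dF i).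
Proof.
move=> dFi; have -> : (fun s => \sum_i F i s) = \sum_i F i.
  by apply/boolp.funext => s; rewrite fct_sumE.
by elim/big_ind2 : _ => // [|] *; [exact: is_derive_cst|exact: is_deriveD].
Qed.

Lemma is_derive_expR_quadratic (u k a : R) :
  is_derive a 1 (fun s => expR (s * u - k * s ^+ 2 / 2))
    (expR (a * u - k * a ^+ 2 / 2) * (u - k * a)).
Proof.
apply: (is_derive1_comp (f := expR) (g := fun s => s * u - k * s ^+ 2 / 2)).
have -> : (fun s => s * u - k * s ^+ 2 / 2) = (fun s => u *: s - (k / 2) *: s ^+ 2).
  by apply/boolp.funext => s; rewrite /GRing.scale /=; ring.
by apply: is_derive_eq; rewrite /GRing.scale /=; field.
Qed.

(** The hypothesis bounds the logarithmic derivative of the Laplace transform by [k * s], so the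
    transform divided by [expR (k * s ^+ 2 / 2)] does not increase on [[0, a]], starting from 1. *)
Lemma herbst_chernoff (p u : I -> R) (k a t : R) :
  (forall i, 0 <= p i) -> \sum_i p i = 1 -> 0 <= a ->
  (forall s, 0 <= s <= a ->
    \sum_i u i * expR (s * u i) * p i <= k * s * \sum_i expR (s * u i) * p i) ->
  \sum_(i | t <= u i) p i <= expR (k * a ^+ 2 / 2 - a * t).
Proof.
move=> p0 p1 a0 hu.
pose psi s := \sum_i p i * expR (s * u i - k * s ^+ 2 / 2).
pose dpsi s := \sum_i p i * (expR (s * u i - k * s ^+ 2 / 2) * (u i - k * s)).
have dpsiP (s : R) : is_derive s 1 psi (dpsi s).
  apply: is_derive_big_sum => i; apply: is_deriveZ.
  exact: is_derive_expR_quadratic.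
have psia : psi a <= 1.
  have -> : 1 = psi 0.
    rewrite -p1; apply: eq_bigr => i _.
    by rewrite mul0r expr0n mulr0 mul0r subr0 expR0 mulr1.
  apply: (@ler0_derive1_nincr _ psi 0 a) => // s.
    rewrite in_itv /= => /andP[s0 sa]; rewrite derive1E derive_val /dpsi.
    have -> : \sum_i p i * (expR (s * u i - k * s ^+ 2 / 2) * (u i - k * s)) =
      expR (- (k * s ^+ 2 / 2)) * (\sum_i u i * expR (s * u i) * p i -
        k * s * \sum_i expR (s * u i) * p i).
      rewrite mulr_sumr -sumrB mulr_sumr; apply: eq_bigr => i _.
      by rewrite expRD; ring.
    by rewrite pmulr_rle0 ?expR_gt0 // subr_le0 hu // !ltW.
  apply: derivable_within_continuous => z _; exact: ex_derive.
(* Markov's inequality at [s = a]: terms with [u i < t] are dropped, and elsewhere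
   [expR (a * (u i - t)) >= 1]. *)
rewrite -[leRHS]mulr1; apply: le_trans (ler_wpM2l (expR_ge0 _) psia).
rewrite mulr_sumr [leRHS](bigID (fun i => t <= u i)) /= -[leLHS]addr0.
apply: lerD; last by apply: sumr_ge0 => i _; rewrite !mulr_ge0 ?expR_ge0.
apply: ler_sum => i tu; rewrite mulrCA -expRD -[leLHS]mulr1.
apply: ler_wpM2l => //; rewrite -[leLHS]expR0 ler_expR.
have -> : k * a ^+ 2 / 2 - a * t + (a * u i - k * a ^+ 2 / 2) = a * (u i - t).
  by ring.
by rewrite mulr_ge0 // subr_ge0.
Qed.
End Herbst.

(** * Counting copies of [S] and their destruction by edge deletions *)

Lemma card_supersets (T : finType) (U : {set T}) (m : nat) :
  (#|U| <= m)%N ->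
  #|[set W : {set T} | (#|W| == m) && (U \subset W)]| = 'C(#|T| - #|U|, m - #|U|).
Proof.
move=> Um.
have -> : (#|T| - #|U| = #|~: U|)%N by rewrite [RHS]cardsCs setCK.
rewrite -(cards_draws (~: U) (m - #|U|)%N).
(* Supersets of [U] correspond to subsets of its complement through [V |-> U :|: V]. *)
rewrite -[RHS](card_in_imset (f := fun V => U :|: V)); last first.
  move=> V V'; rewrite !inE => /andP[VU _] /andP[V'U _] eqV.
  have dV (V0 : {set T}) : V0 \subset ~: U -> V0 = (U :|: V0) :\: U.
    move=> sV; rewrite setDUl setDv set0U; apply/esym/setDidPl.
    by rewrite disjoints_subset.
  by rewrite (dV _ VU) eqV -dV.
congr #|pred_of_set _|; apply/setP => W; rewrite inE; apply/andP/imsetP.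
  case=> /eqP Wm UW; exists (W :\: U); last first.
    by rewrite setDE setUIr setUCr setIT (setUidPr UW).
  by rewrite inE setDE subsetIr -setDE cardsD (setIidPr UW) Wm eqxx.
case=> V; rewrite inE => /andP[VU /eqP cV] ->; rewrite subsetUl cardsU cV.
have -> : U :&: V = set0 by apply/eqP; rewrite setIC setI_eq0 disjoints_subset.
by rewrite cards0 subn0 subnKC.
Qed.

Section Copies.
Variables (n m : nat) (S : graph m).
Implicit Types (G : graph n) (e : vpair n) (W : {set 'I_n}).

Definition copies G : {set {set 'I_n}} :=
  [set W : {set 'I_n} | (#|W| == m) && contains_in S G W].

Definition destroyed G e : {set {set 'I_n}} := copies G :\: copies (upd G e false).

Lemma adj_upd G e u v : adj G u v ->
  adj (upd G e false) u v || ((val e == (u, v)) || (val e == (v, u))).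
Proof.
case/existsP => f /andP[Gf fuv]; have [<-|fe] := eqVneq f e.
  by rewrite fuv orbT.
by apply/orP; left; apply/existsP; exists f; rewrite ffunE (negbTE fe) Gf.
Qed.

Lemma adj_subset (G G' : graph n) u v :
  (forall f, G' f -> G f) -> adj G' u v -> adj G u v.
Proof.
move=> sub /existsP[f /andP[G'f fuv]]; apply/existsP; exists f.
by rewrite sub.
Qed.

Lemma copies_upd G e : copies (upd G e false) \subset copies G.
Proof.
apply/subsetP => W; rewrite !inE => /andP[-> /existsP[h /and3P[ih hW adjh]]] /=.
apply/existsP; exists h; rewrite ih hW /=.
apply/forallP => u; apply/forallP => v; apply/implyP => Suv.
move/forallP/(_ u)/forallP/(_ v)/implyP/(_ Suv): adjh; apply: adj_subset => f.
by rewrite ffunE; case: eqP.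
Qed.

Lemma num_copies_upd G e :
  num_copies S G = (num_copies S (upd G e false) + #|destroyed G e|)%N.
Proof.
rewrite /num_copies -/(copies G) -/(copies (upd G e false)).
rewrite -(cardsID (copies (upd G e false)) (copies G)).
by rewrite (setIidPr (copies_upd G e)).
Qed.

(** Otherwise [h] would still embed [S] after the deletion, and [W] would survive. As [h] is
    arbitrary, one embedding can serve for all [e]. *)
Lemma destroyed_embedding G e W (h : {ffun 'I_m -> 'I_n}) :
  W \in destroyed G e -> injectiveb h -> [forall u, h u \in W] ->
  [forall u, forall v, adj S u v ==> adj G (h u) (h v)] ->
  exists u v, adj S u v && ((val e == (h u, h v)) || (val e == (h v, h u))).
Proof.
rewrite !inE negb_and => /andP[/orP[/negP nm|nc] /andP[cW _]] ih hW adjh.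
  by case: nm.
move: nc; rewrite negb_exists => /forallP/(_ h).
rewrite ih hW /= negb_forall => /existsP[u].
rewrite negb_forall => /existsP[v]; rewrite negb_imply => /andP[Suv nadj].
exists u, v; rewrite Suv /=.
move/forallP/(_ u)/forallP/(_ v)/implyP/(_ Suv): adjh => /(@adj_upd _ e).
by rewrite (negbTE nadj).
Qed.

Lemma destroyed_ends G e W : W \in destroyed G e ->
  [set (val e).1; (val e).2] \subset W.
Proof.
move=> We; have := We; rewrite in_setD => /andP[_].
rewrite inE => /andP[_ /existsP[h /and3P[ih hW adjh]]].
have [u [v /andP[_ euv]]] := destroyed_embedding We ih hW adjh.
rewrite subUset !sub1set.
by case/orP: euv => /eqP -> /=; rewrite !(forallP hW).
Qed.

(** A destroyed copy contains both ends of [e], so only its other [m - 2] vertices are free. *)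
Lemma card_destroyed G e : (2 <= m)%N -> (#|destroyed G e| <= 'C(n - 2, m - 2))%N.
Proof.
move=> m2; set U := [set (val e).1; (val e).2].
have U2 : #|U| = 2.
  by rewrite cards2 neq_ltn; have := valP e => /= ->.
have -> : 'C(n - 2, m - 2) = 'C(#|'I_n| - #|U|, m - #|U|) by rewrite card_ord U2.
rewrite -card_supersets ?U2 //.
apply: subset_leq_card; apply/subsetP => W We; rewrite inE (destroyed_ends We).
by move: We; rewrite !inE => /andP[_ /andP[-> _]].
Qed.

(* Fix an embedding of [S] into [G] inside [W]: only the deletion of one of its
   edges can destroy the copy [W]. *)
Lemma card_destroying G W : W \in copies G ->
  (#|[set e | W \in destroyed G e]| <= num_edges S)%N.
Proof.
rewrite inE => /andP[_ /existsP[h /and3P[ih hW adjh]]].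
(* Pairs are stored increasingly but [h] need not be monotone, hence both orientations. *)
pose img (e : vpair n) (f : vpair m) :=
  (val e == (h (val f).1, h (val f).2)) || (val e == (h (val f).2, h (val f).1)).
have key e : W \in destroyed G e -> exists f, S f && img e f.
  move=> We; have [u [v /andP[/existsP[f /andP[Sf fuv]] euv]]] :=
    destroyed_embedding We ih hW adjh.
  exists f; rewrite Sf /img.
  by case/orP: fuv => /eqP -> //=; rewrite orbC.
have img_inj e e' f : img e f -> img e' f -> e = e'.
  have le := valP e; have le' := valP e'; rewrite /img => he he'.
  apply: val_inj; move: le le'.
  case/orP: he => /eqP -> /=; case/orP: he' => /eqP -> //= le le'.
    by move: (ltn_trans le le'); rewrite ltnn.
  by move: (ltn_trans le le'); rewrite ltnn.
(* Choosing for each destroying edge a preimage in [S] is injective, since an edge of [S] has only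
   one image. *)
pose F e := [pick f | S f && img e f].
rewrite -(card_in_imset (f := F)) => [|e e'].
  rewrite /num_edges -(card_imset [set f | S f] (@Some_inj _)).
  apply: subset_leq_card.
  apply/subsetP => _ /imsetP[e + ->]; rewrite inE => /key[f Hf]; rewrite /F.
  case: pickP => [f' /andP[Sf' _]|/(_ f)]; last by rewrite Hf.
  by rewrite imset_f // inE.
rewrite inE => /key[f Hf] _; rewrite /F.
case: pickP => [f1 /andP[_ if1]|/(_ f)]; last by rewrite Hf.
by case: pickP => // f2 /andP[_ if2] [ff]; apply: img_inj if1 _; rewrite ff.
Qed.

(** Double counting of pairs of an edge and a copy that it destroys, with the sum over copies taken
    outside. *)
Lemma sum_card_destroyed G :
  (\sum_(e | G e) #|destroyed G e| <= num_edges S * num_copies S G)%N.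
Proof.
apply: (@leq_trans (\sum_e #|destroyed G e|)).
  by rewrite [leqRHS](bigID G) leq_addr.
under eq_bigr do rewrite -sum1_card big_mkcond /=.
rewrite exchange_big /= mulnC -sum_nat_const [leqRHS]big_mkcond.
apply: leq_sum => W _; rewrite -/(copies G); case: ifPn => [/card_destroying|nW].
  by rewrite -sum1_card big_mkcond /=; under eq_bigr do rewrite inE.
by rewrite big1 // => e _; rewrite in_setD (negbTE nW) andbF.
Qed.
End Copies.

(** * Tail bounds for self-bounding functions under the Dobrushin condition *)

Section SelfBounding.
Variables (R : realType) (E : finType) (p : {ffun E -> bool} -> R).
Variables (A : E -> E -> R) (f : {ffun E -> bool} -> R) (M v : R).
Implicit Types (x : {ffun E -> bool}) (e : E) (w : {ffun E -> bool} -> R).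
Hypothesis p_gt0 : forall x, 0 < p x.
Hypothesis p1 : \sum_x p x = 1.
Hypothesis E_gt0 : (0 < #|E|)%N.
Hypotheses (hA : dobrushin_matrix p A) (A1 : norm1 A < 1).
Hypotheses (M_gt0 : 0 < M) (v_ge1 : 1 <= v) (f_ge0 : forall x, 0 <= f x).
Hypothesis f_incr : forall x e, x e -> 0 <= f x - f (upd x e false) <= M.
Hypothesis f_self_bounding : forall x,
  \sum_(e | x e) (f x - f (upd x e false)) <= v * f x.

(** Variance proxy per unit of mean: Herbst's constant is [C * (mu + t)] for the upper tail and
    [2 * (C * mu)] for the lower one. *)
Let C := M * v / (1 - norm1 A).
Let mu := expect p f.

Lemma self_bounding_lipschitz : coord_lipschitz M f.
Proof.
move=> e x; have := @f_incr (upd x e true) e; rewrite upd_eq upd_upd => /(_ isT).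
by case/andP => ? ?; rewrite ger0_norm.
Qed.

Lemma C_ge_M : M <= C.
Proof.
have A0 : 0 <= norm1 A by rewrite bigmax_ge_id.
rewrite /C ler_pdivlMr ?subr_gt0 //; apply: ler_wpM2l; first exact: ltW.
by move: v_ge1; lra.
Qed.

Lemma C_gt0 : 0 < C.
Proof. exact: lt_le_trans M_gt0 C_ge_M. Qed.

Lemma expect_ge0 g : (forall x, 0 <= g x) -> 0 <= expect p g.
Proof. by move=> g0; apply: sumr_ge0 => x _; rewrite mulr_ge0 // ltW. Qed.

(** Summing the increments over [e] at fixed [x] lets self-bounding turn the gradient mass of [w]
    into a multiple of the mean of [f * g]. *)
Lemma self_bounding_covariance (c : R) w g : 0 <= c -> (forall x, 0 <= g x) ->
  (forall x e, x e -> `|w x - w (upd x e false)| <=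
     c * (f x - f (upd x e false)) * g x) ->
  covariance p f w <= c * C * expect p (fun x => f x * g x).
Proof.
move=> c0 g0 hw.
have M0 := ltW M_gt0.
apply: le_trans (covariance_le p_gt0 p1 w hA A1 E_gt0 M0 self_bounding_lipschitz) _.
have -> : c * C * expect p (fun x => f x * g x) =
  M / (1 - norm1 A) * (c * v * expect p (fun x => f x * g x)) by rewrite /C; ring.
apply: ler_wpM2l; first by rewrite divr_ge0 // subr_ge0 ltW.
rewrite /gradient_mass (exchange_big_dep xpredT) //= /expect mulr_sumr.
apply: ler_sum => x _; rewrite -mulr_sumr mulrA [leRHS]mulrC.
apply: ler_wpM2l; first exact: ltW.
apply: le_trans (ler_sum _ (fun e => hw x e)) _.
rewrite -mulr_suml -mulr_sumr mulrA; apply: ler_wpM2r => //.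
by rewrite -mulrA; apply: ler_wpM2l.
Qed.

Lemma expect_eq0 : mu = 0 -> forall x, f x = 0.
Proof.
move=> mu0 x.
have /eqP : f x * p x = 0.
  by apply: (psumr_eq0P _ mu0) => // y _; rewrite mulr_ge0 // ltW.
by rewrite mulf_eq0 (gt_eqF (p_gt0 x)) orbF => /eqP.
Qed.

Lemma prob_le1 (B : pred {ffun E -> bool}) : prob p B <= 1.
Proof.
rewrite /prob -p1 [leRHS](bigID B) /= lerDl.
by apply: sumr_ge0 => x _; exact: ltW.
Qed.

Lemma self_bounding_upper_tail (t : R) : 0 <= t ->
  prob p [pred x | f x - mu >= t] <= expR (- (t ^+ 2 / (2 * C * (mu + t)))).
Proof.
rewrite le_eqVlt => /predU1P[<-|t0].
  by rewrite expr0n mul0r oppr0 expR0 prob_le1.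
(* A zero mean forces [f] to vanish, so the event is empty; afterwards [mu > 0] allows cancelling
   [mu]. *)
have := expect_ge0 f_ge0; rewrite -/mu le_eqVlt => /predU1P[mu0|mu0].
  rewrite /prob big_pred0 ?expR_ge0 // => x /=.
  by rewrite (expect_eq0 (esym mu0)) -mu0 subr0 leNgt t0.
have C0 := C_gt0; have mt0 : 0 < mu + t by rewrite addr_gt0.
have Cm0 : 0 < C * (mu + t) by rewrite mulr_gt0.
(* Minimizer of [k * a ^+ 2 / 2 - a * t] for [k = C * (mu + t)]. *)
pose a := t / (C * (mu + t)).
have -> : - (t ^+ 2 / (2 * C * (mu + t))) = C * (mu + t) * a ^+ 2 / 2 - a * t.
  by rewrite /a; field; rewrite !gt_eqF.
apply: herbst_chernoff => //; first by move=> x; exact: ltW.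
  by rewrite divr_ge0 // ltW.
move=> s /andP[s0 sa].
pose w x := expR (s * f x).
have cov_le : covariance p f w <= s * C * expect p (fun x => f x * w x).
  apply: self_bounding_covariance => // [x|x e xe]; first exact: expR_ge0.
  have /andP[d0 _] := f_incr xe; rewrite /w.
  rewrite ger0_norm; last first.
    by rewrite subr_ge0 ler_expR ler_wpM2l // -subr_ge0.
  have -> : s * f (upd x e false) = s * f x - s * (f x - f (upd x e false)) by ring.
  rewrite expRD; have := expR_ge1Dx (- (s * (f x - f (upd x e false)))).
  by move: (expR_gt0 (s * f x)); nra.
have shift x : expR (s * (f x - mu)) = expR (- (s * mu)) * w x.
  by rewrite /w -expRD; congr expR; ring.
set X := expect p (fun x => f x * w x) in cov_le.
set Y := expect p w.
have -> : \sum_x (f x - mu) * expR (s * (f x - mu)) * p x =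
    expR (- (s * mu)) * (X - mu * Y).
  rewrite /X /Y /expect mulr_sumr -sumrB mulr_sumr; apply: eq_bigr => x _.
  by rewrite shift; ring.
have -> : \sum_x expR (s * (f x - mu)) * p x = expR (- (s * mu)) * Y.
  by rewrite mulr_sumr; apply: eq_bigr => x _; rewrite shift mulrA.
rewrite mulrCA; apply: ler_wpM2l; first exact: expR_ge0.
move: cov_le; rewrite /covariance -/X -/Y -/mu => cov_le.
have X0 : 0 <= X by apply: expect_ge0 => x; rewrite mulr_ge0 ?expR_ge0.
have sC : s * (C * (mu + t)) <= t by rewrite -ler_pdivlMr.
(* Multiply [(1 - s * C) * X <= mu * Y] by [mu + t]; as [s * C * (mu + t) <= t], at least [mu * X]
   remains on the left. *)
have XY : X <= (mu + t) * Y.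
  rewrite -(ler_pM2l mu0).
  by nra.
apply: le_trans cov_le _.
have -> : C * (mu + t) * s * Y = s * C * ((mu + t) * Y) by ring.
by apply: ler_wpM2l; rewrite // mulr_ge0 // ltW.
Qed.

(** [expR u <= 1 / (1 - u)], which is at most [1 + 2 * u] up to [u = 1 / 2]. *)
Lemma expR_le1D2x (u : R) : 0 <= u <= 1 / 2 -> expR u <= 1 + 2 * u.
Proof.
move=> /andP[u0 u1]; have := expR_ge1Dx (- u); rewrite expRN => h.
have e0 := expR_gt0 u.
have : expR u * (1 - u) <= 1 by rewrite mulrC -ler_pdivlMr // mul1r.
by nra.
Qed.

Lemma self_bounding_lower_tail (t : R) : 0 <= t ->
  prob p [pred x | f x - mu <= - t] <= expR (- (t ^+ 2 / (4 * C * mu))).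
Proof.
rewrite le_eqVlt => /predU1P[<-|t0].
  by rewrite expr0n mul0r oppr0 expR0 prob_le1.
have C0 := C_gt0; have CM := C_ge_M.
(* For [t > mu] the event would require [f < 0]. *)
have [tmu|mut] := leP t mu; last first.
  rewrite /prob big_pred0 ?expR_ge0 // => x /=.
  by apply/negP => le; move: (f_ge0 x) le; lra.
have mu0 : 0 < mu by exact: lt_le_trans tmu.
have Cm0 : 0 < C * mu by rewrite mulr_gt0.
pose a := t / (2 * (C * mu)).
have -> : - (t ^+ 2 / (4 * C * mu)) = 2 * (C * mu) * a ^+ 2 / 2 - a * t.
  by rewrite /a; field; rewrite !gt_eqF.
have -> : prob p [pred x | f x - mu <= - t] = \sum_(x | t <= mu - f x) p x.
  by apply: eq_bigl => x /=; rewrite lerNr opprB.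
apply: herbst_chernoff => //; first by move=> x; exact: ltW.
  by rewrite divr_ge0 // ltW // mulr_gt0.
move=> s /andP[s0 sa].
(* Keeps [s] times any increment of [f] within reach of [expR_le1D2x]: [2 * s * C * mu <= t <= mu]
   and [M <= C]. *)
have sM : s * M <= 1 / 2.
  have sC : s * (2 * (C * mu)) <= t by rewrite -ler_pdivlMr // mulr_gt0.
  have MC : s * mu * M <= s * mu * C by rewrite ler_wpM2l // mulr_ge0 // ltW.
  by rewrite -(ler_pM2r mu0); move: sC MC tmu; lra.
pose w x := expR (- (s * f x)).
have cov_le : covariance p f (fun x => - w x) <=
    2 * s * C * expect p (fun x => f x * w x).
  apply: self_bounding_covariance => // [|x|x e xe]; first by rewrite mulr_ge0.
    exact: expR_ge0.
  have /andP[d0 dM] := f_incr xe; rewrite /w opprK addrC.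
  rewrite ger0_norm; last first.
    by rewrite subr_ge0 ler_expR lerN2 ler_wpM2l // -subr_ge0.
  have -> : - (s * f (upd x e false)) =
    - (s * f x) + s * (f x - f (upd x e false)) by ring.
  rewrite expRD; have := @expR_le1D2x (s * (f x - f (upd x e false))).
  rewrite mulr_ge0 //= (le_trans _ sM) ?ler_wpM2l // => /(_ isT).
  by move: (expR_gt0 (- (s * f x))); nra.
have shift x : expR (s * (mu - f x)) = expR (s * mu) * w x.
  by rewrite /w -expRD; congr expR; ring.
set X := expect p (fun x => f x * w x) in cov_le.
set Y := expect p w.
have -> : \sum_x (mu - f x) * expR (s * (mu - f x)) * p x =
    expR (s * mu) * (mu * Y - X).
  rewrite /X /Y /expect mulr_sumr -sumrB mulr_sumr; apply: eq_bigr => x _.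
  by rewrite shift; ring.
have -> : \sum_x expR (s * (mu - f x)) * p x = expR (s * mu) * Y.
  by rewrite mulr_sumr; apply: eq_bigr => x _; rewrite shift mulrA.
rewrite mulrCA; apply: ler_wpM2l; first exact: expR_ge0.
have Y0 : 0 <= Y by apply: expect_ge0 => x; exact: expR_ge0.
(* If [X] exceeds [mu * Y], the left side is negative; otherwise [X <= mu * Y] replaces [X] in the
   covariance bound. *)
have [XY|YX] := leP X (mu * Y); last first.
  apply: (@le_trans _ _ 0); first by rewrite subr_le0 ltW.
  by do 2!(apply: mulr_ge0 => //); rewrite mulr_ge0 // ltW.
have cov_eq : covariance p f (fun x => - w x) = mu * Y - X.
  rewrite /covariance /X /Y /mu /expect.
  under eq_bigr do rewrite mulrN mulNr.
  under [X in _ - _ * X]eq_bigr do rewrite mulNr.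
  by rewrite !sumrN mulrN opprK addrC.
rewrite cov_eq in cov_le; apply: le_trans cov_le _.
have -> : 2 * (C * mu) * s * Y = 2 * s * C * (mu * Y) by ring.
by apply: ler_wpM2l => //; rewrite mulr_ge0 ?(ltW C0) // mulr_ge0.
Qed.
End SelfBounding.

(** * The exponential random graph: normalization and tails of [N_S] *)

Section ErgmLaw.
Variables (R : realType) (n k : nat).
Variables (T : 'I_k -> graph n -> R) (beta : 'I_k -> R).

Lemma ergm_sum1 : \sum_G ergm T beta G = 1.
Proof.
rewrite /ergm /ergm_psi; set Z : R := \sum_G expR (\sum_(i < k) beta i * T i G).
have Z0 : 0 < Z.
  rewrite /Z (bigD1 [ffun=> true]) //= ltr_pwDl ?expR_gt0 //.
  by apply: sumr_ge0 => G _; exact: expR_ge0.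
under eq_bigr do rewrite expRD expRN lnK ?posrE //.
by rewrite -mulr_suml divff // gt_eqF.
Qed.
End ErgmLaw.

Theorem theorem4p13 (R : realType) (n k : nat)
    (T : 'I_k -> graph n -> R) (beta : 'I_k -> R)
    (A : vpair n -> vpair n -> R)
    (hA : dobrushin_matrix (ergm T beta) A)
    (hA1 : norm1 A < 1) (hAinf : norm_infty A < 1)
    (nS : nat) (S : graph nS)
    (hnS2 : (2 <= nS)%N) (hnSn : (nS <= n)%N) (heS : (1 <= num_edges S)%N)
    (t : R) (ht : 0 <= t) :
  let P := prob (ergm T beta) in
  let N := fun G : graph n => (num_copies S G)%:R : R in
  let EN := expect (ergm T beta) N in
  let c := 'C(n - 2, nS - 2)%:R * (num_edges S)%:R : R in
  P [pred G | N G - EN >= t] <=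
    expR (- ((1 - norm1 A) * t ^+ 2 / (2 * c * (EN + t))))
  /\
  P [pred G | N G - EN <= - t] <=
    expR (- ((1 - norm1 A) * t ^+ 2 / (8 * c * EN))).
Proof.
move=> P N EN c.
have p0 G : 0 < ergm T beta G by exact: expR_gt0.
have p1 := ergm_sum1 T beta.
have E0 : (0 < #|vpair n|)%N.
  have n0 : (0 < n)%N by lia.
  have n1 : (1 < n)%N by lia.
  by apply/card_gt0P; exists (exist _ (Ordinal n0, Ordinal n1) isT).
have M0 : 0 < 'C(n - 2, nS - 2)%:R :> R by rewrite ltr0n bin_gt0 leq_sub2r.
have v1 : 1 <= (num_edges S)%:R :> R by rewrite ler1n.
have N0 G : 0 <= N G by rewrite ler0n.
have dN G e : N G - N (upd G e false) = #|destroyed S G e|%:R.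
  by rewrite /N (num_copies_upd S G e) natrD addrAC subrr add0r.
have Nincr (G : graph n) e :
    G e -> 0 <= N G - N (upd G e false) <= 'C(n - 2, nS - 2)%:R.
  by rewrite dN ler0n ler_nat card_destroyed.
have Nsb (G : graph n) :
    \sum_(e | G e) (N G - N (upd G e false)) <= (num_edges S)%:R * N G.
  under eq_bigr do rewrite dN.
  by rewrite -natr_sum -natrM ler_nat sum_card_destroyed.
have A1 : 0 < 1 - norm1 A by rewrite subr_gt0.
have c0 : 0 < c by rewrite mulr_gt0 // (lt_le_trans ltr01).
split.
  (* With the binomial as [M] and the edge count as [v], the constant [C] is [c / (1 - norm1 A)]. *)
  apply: le_trans (self_bounding_upper_tail p0 p1 E0 hA hA1 M0 v1 N0 Nincr Nsb ht) _.
  rewrite ler_expR lerN2 -/c -/EN le_eqVlt; apply/orP; left; apply/eqP.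
  by rewrite !invfM invrK; ring.
apply: le_trans (self_bounding_lower_tail p0 p1 E0 hA hA1 M0 v1 N0 Nincr Nsb ht) _.
have EN0 : 0 <= EN by apply: sumr_ge0 => G _; rewrite mulr_ge0 // ltW.
rewrite ler_expR lerN2 -/c -/EN.
(* The general bound has [4] where [8] is claimed, so its exponent is twice as large. *)
have -> : t ^+ 2 / (4 * (c / (1 - norm1 A)) * EN) =
  2 * ((1 - norm1 A) * t ^+ 2 / (8 * c * EN)).
  rewrite !invfM invrK.
  have -> : (4 : R)^-1 = 2 * 8^-1 by lra.
  by ring.
rewrite ler_peMl ?ler1n //.
by rewrite divr_ge0 ?mulr_ge0 ?sqr_ge0 // ?ltW.
Qed.
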